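(* For every positive integer $\Delta$, \[ \chi'(2,\Delta) \le \left\lfloor \tfrac{3}{2} \Delta + 4 \right\rfloor. \] Equivalently: for any two finite simple loopless graphs $G_1,G_2$ on a common vertex set, each of maximum degree at most $\Delta$, there is an edge-coloring of their union using at most $\lfloor \frac32 \Delta + 4\rfloor$ colors whose restrictions to the edge sets of $G_1$ and of $G_2$ are proper edge-colorings.
   Context: All graphs are finite, simple and loopless. A (proper) edge-coloring of a graph is a coloring of its edges such that any two edges sharing an endpoint receive distinct colors. The union of graphs $G_1,\ldots,G_\ell$ on the same vertex set $V$ is the simple graph $G$ on $V$ in which $uv$ is an edge iff $uv$ is an edge of at least one $G_i$. An edge-coloring of $G$ is simultaneous with respect to $G_1,\ldots,G_\ell$ if its restriction to the edge set of each $G_i$ is a proper edge-coloring of $G_i$. $\chi'(G_1,\ldots,G_\ell)$ denotes the minimum number of colors of a simultaneous edge-coloring of their union, and $\chi'(\ell,\Delta)$ denotes the largest integer $k$ such that $k=\chi'(G_1,\ldots,G_\ell)$ for some graphs $G_1,\ldots,G_\ell$ on a common vertex set, each of maximum degree at most $\Delta$. *)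

(* Defs.v *)
From mathcomp Require Import all_boot.
Set Implicit Arguments.
Unset Strict Implicit.
Unset Printing Implicit Defensive.

Record sgraph (V : finType) := SGraph {
  adj :> rel V;
  adj_sym : symmetric adj;
  adj_irr : irreflexive adj
}.

Definition edges (V : finType) (G : sgraph V) : {set {set V}} :=
  [set e | [exists x, exists y, G x y && (e == [set x; y])]].

Notation edge G := {e : {set _} | e \in edges G}.

Definition degree (V : finType) (G : sgraph V) (v : V) : nat :=
  #|[set w | G v w]|.

Definition max_degree (V : finType) (G : sgraph V) : nat :=
  \max_(v : V) degree G v.

Definition proper_edge_coloring (V : finType) (G : sgraph V) (C : eqType)
    (c : edge G -> C) : bool :=
  [forall e : edge G, forall f : edge G,
    (e != f) && ~~ [disjoint val e & val f] ==> (c e != c f)].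

Section Union.
Variables (l : nat) (V : finType) (Gs : l.-tuple (sgraph V)).

Definition union_adj : rel V := fun x y => [exists i, tnth Gs i x y].

Lemma union_sym : symmetric union_adj.
Proof. by move=> x y; apply: eq_existsb => i; rewrite adj_sym. Qed.

Lemma union_irr : irreflexive union_adj.
Proof. by move=> x; apply/existsP => -[i]; rewrite adj_irr. Qed.

Definition union_graph : sgraph V := SGraph union_sym union_irr.

Lemma edges_union (i : 'I_l) (e : {set V}) :
  e \in edges (tnth Gs i) -> e \in edges union_graph.
Proof.
rewrite !inE => /existsP[x /existsP[y /andP[xy exy]]].
apply/existsP; exists x; apply/existsP; exists y.
by rewrite exy andbT; apply/existsP; exists i.
Qed.

Definition edge_union (i : 'I_l) (e : edge (tnth Gs i)) : edge union_graph :=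
  exist _ (val e) (edges_union (valP e)).

Definition simultaneous (C : eqType) (c : edge union_graph -> C) : bool :=
  [forall i : 'I_l, proper_edge_coloring (fun e => c (@edge_union i e))].

(* Colors that are never used are allowed: this is "at most k colors". *)
Definition simul_colorable (k : nat) : bool :=
  [exists c : {ffun edge union_graph -> 'I_k}, simultaneous c].

Lemma simul_colorable_ex : exists k, simul_colorable k.
Proof.
exists #|{: edge union_graph}|; apply/existsP; exists [ffun e => enum_rank e].
apply/forallP => i; apply/forallP => e; apply/forallP => f.
apply/implyP => /andP[/eqP nef _]; rewrite !ffunE (inj_eq enum_rank_inj).
by apply/eqP => /(congr1 val) /= /val_inj.
Qed.

Definition simul_chromatic_index : nat := ex_minn simul_colorable_ex.

End Union.

Definition attained_index (l D k : nat) : Prop :=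
  exists (V : finType) (Gs : l.-tuple (sgraph V)),
    (forall i : 'I_l, max_degree (tnth Gs i) <= D) /\
    simul_chromatic_index Gs = k.

(* The largest attained value may a priori not exist, so it is given as a
   relation. *)
Definition is_max_simul_index (l D k : nat) : Prop :=
  attained_index l D k /\ (forall j, attained_index l D j -> j <= k).

(* Main.v *)
Require Import Defs.
From mathcomp Require Import all_boot all_order all_algebra.
From mathcomp Require Import perm zify.
From Stdlib Require Import Classical_Prop.
Set Implicit Arguments.
Unset Strict Implicit.
Unset Printing Implicit Defensive.

(** Put D = 2k or 2k+1, A = G1 minus G2, B = G2 minus G1 and C = the common
edges.  Use three palettes: palette 1 (k+1 colors) for edges of A and B,
palette 2 for edges of A and C, palette 3 for edges of B and C.  By Vizing's
theorem, palettes 2 and 3 need only one color more than the maximum degrees of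
the subgraphs they receive, so it suffices to distribute the edges so that these
degrees are at most k + (D mod 2) and k + 1, and palette 1 can be used properly.

Color A properly with pairs (i, s), i <= k, s a bit, and likewise B.  In a pair
class i the edges form paths and even cycles; swapping the bits along any of
them keeps the coloring proper, and the edges of bit 0 go to palette 1 with
color i.  The common edges are oriented and cut, separately for outgoing and
incoming ends, into alternating trails, which are swapped in the same way.  The
ends of these paths and trails are matched at each vertex, at most four of them
remaining (one of A, one of B, two of C), and each match asks that its two
ends do not both lie in one prescribed overloaded palette.  Following the
chains of paths and matches, the bit of each path can be chosen so that its
last end is not overloading, which satisfies all the matches at once. *)

(** * Vizing's theorem *)

(** In maximum degree two, a walk that has entered [x] from [z] and never turns back has only one
    continuation, so two such walks cannot diverge. *)
Lemma uniq_walk_prefix (V : eqType) (R : rel V) :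
  symmetric R ->
  (forall x y z t, R x y -> R x z -> R x t -> [|| y == z, y == t | z == t]) ->
  forall (p q : seq V) (z x : V), R x z ->
    path R x p -> path R x q -> uniq (z :: x :: p) -> uniq (z :: x :: q) ->
  prefix p q || prefix q p.
Proof.
move=> Rsym deg2; elim=> [|a p IHp] [|b q] z x // Rxz.
move=> /andP[Rxa pp] /andP[Rxb pq] Up Uq.
move: (Up) (Uq); rewrite /= !inE !negb_or.
move=> /andP[/andP[_ /andP[za _]] _] /andP[/andP[_ /andP[zb _]] _].
have /or3P[|| /eqP ab] := deg2 _ _ _ _ Rxz Rxa Rxb.
- by rewrite (negPf za).
- by rewrite (negPf zb).
rewrite -ab in pq Uq *; rewrite /= !eqxx /=.
apply: (IHp q x a) => //; first by rewrite Rsym.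
  by case/andP: Up.
by case/andP: Uq.
Qed.

(** A component of maximum degree two is a path or a cycle, so at most two of its vertices have
    degree at most one. Of two simple paths from [x] to [y] and to [z], one extends the other, and
    the shorter would stop at a vertex with two neighbors. *)
Lemma connect_two_ends (V : finType) (R : rel V) :
  symmetric R ->
  (forall x y z t, R x y -> R x z -> R x t -> [|| y == z, y == t | z == t]) ->
  forall x y z, connect R x y -> connect R x z ->
  (forall w, w \in [:: x; y; z] -> forall s t, R w s -> R w t -> s = t) ->
  ~~ uniq [:: x; y; z].
Proof.
move=> Rsym deg2 x y z /connectP[p0 pp0 ->] /connectP[q0 pq0 ->].
case/shortenP: pp0 => p pp Up _; case/shortenP: pq0 => q pq Uq _ end1.
wlog : p q pp pq Up Uq end1 / prefix p q.
  move=> H; have [/H|npq] := boolP (prefix p q); first exact.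
  have qp : prefix q p.
    case: p q pp pq Up Uq end1 npq {H} => [|a p] [|b q] //= /andP[xa pp] /andP[xb pq].
    move=> Up Uq end1.
    have eab : a = b by apply: (end1 x); rewrite ?inE ?eqxx.
    rewrite -eab in pq Uq * => npq; rewrite eqxx /= in npq *.
    have := uniq_walk_prefix Rsym deg2 (z := x) (x := a) _ pp pq Up Uq.
    by rewrite Rsym xa (negPf npq) => /(_ isT).
  have e : perm_eq [:: x; last x p; last x q] [:: x; last x q; last x p].
    by rewrite perm_cons (perm_catC [:: _] [:: _]).
  by rewrite (perm_uniq e); apply: H => // w; rewrite -(perm_mem e); apply: end1.
case/prefixP=> r qE; apply/negP; rewrite /= !inE !negb_or !andbT.
move=> /andP[/andP[nxp nxq] npq].
case: r qE => [|c r] qE; first by rewrite qE cats0 eqxx in npq.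
case/lastP: p pp Up end1 nxp npq qE => [|p w]; first by rewrite eqxx.
rewrite last_rcons rcons_path => /andP[pp lw] Up end1 _ _ qE.
have lc : R w c.
  by move: pq; rewrite qE cat_path last_rcons /= => /and3P[].
have wl : R w (last x p) by rewrite Rsym.
have elc : last x p = c by apply: (end1 w); rewrite ?inE ?eqxx ?orbT.
move: Uq; rewrite qE -cat_cons cat_uniq => /and3P[_ /hasPn /(_ c)].
rewrite mem_head => /(_ isT) /negP []; rewrite -elc -rcons_cons mem_rcons inE.
by rewrite mem_last orbT.
Qed.

(** Functions on ordered pairs are easy to recolor piecewise; values outside [H] are arbitrary. *)
Definition proper_on (V : Type) (K : eqType) (H : rel V) (c : V -> V -> K) :=
  (forall x y, H x y -> c x y = c y x) /\
  (forall x y z, H x y -> H x z -> c x y = c x z -> y = z).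

Section Star.
Variables V K : finType.

(* [L u] is a set of colors missing at [u].  Swapping [i] and [j] on one Kempe
component meets at most two of the vertices offering [j], so [j] stays in use
while [i] comes into use. *)
Lemma kempe_swap (H : rel V) (S : {set K}) (c : V -> V -> K) (N : {set V})
    (L : V -> {set K}) (i j : K) :
  symmetric H -> proper_on H c ->
  (forall x y, H x y -> c x y \in S) ->
  (forall u, u \in N -> L u \subset S) ->
  (forall u y, u \in N -> H u y -> c u y \notin L u) ->
  i \in S -> j \in S ->
  (forall u, u \in N -> i \notin L u) -> 2 < #|[set u in N | j \in L u]| ->
  exists (c' : V -> V -> K) (L' : V -> {set K}),
  [/\ proper_on H c', (forall x y, H x y -> c' x y \in S),
    (forall u, u \in N -> L' u \subset S /\ #|L' u| = #|L u|),
    (forall u y, u \in N -> H u y -> c' u y \notin L' u) &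
    [set l in S | [forall u in N, l \notin L' u]] \proper
    [set l in S | [forall u in N, l \notin L u]]].
Proof.
move=> Hsym [csym cprop] cS LS Lmiss iS jS Xi0 Xj3.
have [u /setIdP[uN ju]] : exists u, u \in [set u in N | j \in L u].
  by apply/card_gt0P; apply: leq_trans Xj3.
pose R := [rel x y | H x y && (c x y \in [set i; j])].
have Rsym : symmetric R.
  by move=> x y /=; rewrite Hsym; case yx: (H y x) => //=; rewrite (csym _ _ yx).
have Rdeg x y z t : R x y -> R x z -> R x t -> [|| y == z, y == t | z == t].
  move=> /andP[xy cy] /andP[xz cz] /andP[xt ct].
  have [e|nyz] := eqVneq (c x y) (c x z); first by rewrite (cprop x y z) ?eqxx.
  have [e|nyt] := eqVneq (c x y) (c x t); first by rewrite (cprop x y t) ?eqxx ?orbT.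
  have [e|nzt] := eqVneq (c x z) (c x t); first by rewrite (cprop x z t) ?eqxx ?orbT.
  move: cy cz ct nyz nyt nzt; rewrite !inE.
  by move=> /orP[]/eqP-> /orP[]/eqP-> /orP[]/eqP->; rewrite ?eqxx.
have Rs : connect_sym R := sym_connect_sym Rsym.
pose Z := [set x | connect R u x].
(* An edge leaving the component has a color other than [i] and [j], so the swap treats it alike at
   both ends. *)
have ZR x y : H x y -> (x \in Z) != (y \in Z) -> c x y \notin [set i; j].
  move=> xy; apply: contraNN => cxy; rewrite !inE; apply/eqP.
  by apply: (same_connect_r Rs); apply: connect1; rewrite /= xy cxy.
pose s := tperm i j.
pose swap x l := if x \in Z then s l else l.
have swapK x : involutive (swap x).
  by move=> l; rewrite /swap; case: (x \in Z) => //; rewrite /s tpermK.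
have swapI x : injective (swap x) := inv_inj (swapK x).
have swapS x l : (swap x l \in S) = (l \in S).
  rewrite /swap /s; case: ifP => // _.
  by case: tpermP => [->|->|//]; rewrite iS jS.
have swapN x l : l \notin [set i; j] -> swap x l = l.
  rewrite !inE negb_or /swap /s => /andP[li lj]; case: ifP => // _.
  by rewrite tpermD // eq_sym.
exists (fun x y => swap x (c x y)), (fun x => swap x @^-1: L x); split.
- split=> [x y xy|x y z xy xz /swapI]; last exact: cprop.
  rewrite -(csym _ _ xy); have [e|ne] := eqVneq (x \in Z) (y \in Z).
    by rewrite /swap e.
  by rewrite !swapN ?ZR.
- by move=> x y xy; rewrite swapS cS.
- move=> x xN; split; last by rewrite card_preimset.
  by apply/subsetP=> l; rewrite inE => /(subsetP (LS _ xN)); rewrite swapS.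
- by move=> x y xN xy; rewrite inE swapK Lmiss.
apply/properP; split; last first.
  exists i; first by rewrite !inE iS; apply/forall_inP.
  rewrite !inE iS /=; apply/forall_inPn; exists u => //.
  by rewrite inE negbK /swap !inE connect0 /s tpermL.
apply/subsetP=> l; rewrite !inE => /andP[lS /forall_inP h]; rewrite lS /=.
have [->|nli] := eqVneq l i; first exact/forall_inP.
have [elj|nlj] := eqVneq l j; last first.
  by apply/forall_inP => x xN; move: (h x xN); rewrite inE swapN // !inE negb_or nli.
exfalso; rewrite {l nli lS}elj in h.
have : [set u in N | j \in L u] \subset Z.
  apply/subsetP=> w /setIdP[wN jw]; apply: contraT => wZ.
  by move: (h w wN); rewrite inE /swap (negPf wZ) jw.
(* Three vertices missing [j] would lie in one component, each meeting it only in an edge of color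
   [i]. *)
move=> XZ; have [w [Uw sw wX]] := card_geqP Xj3.
case: w Uw sw wX => [|w1 [|w2 [|w3 []]]] // Uw _ wX.
have wZ w : w \in [:: w1; w2; w3] -> connect R u w.
  by move=> /wX /(subsetP XZ); rewrite inE.
move: Uw; apply/negP; apply: (@connect_two_ends V R Rsym Rdeg).
- by rewrite (same_connect Rs (y := u)) ?wZ ?inE ?eqxx ?orbT // Rs wZ // inE eqxx.
- by rewrite (same_connect Rs (y := u)) ?wZ ?inE ?eqxx ?orbT // Rs wZ // inE eqxx.
move=> w /wX /setIdP[wN jw].
suff ci x : R w x -> c w x = i.
  move=> x y wx wy; apply: (cprop w); last by rewrite !ci.
    by case/andP: wx.
  by case/andP: wy.
case/andP=> wx; rewrite !inE => /orP[/eqP//|/eqP cj].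
by have := Lmiss _ _ wN wx; rewrite cj jw.
Qed.

Lemma sum_card_occ (N : {set V}) (L : V -> {set K}) (S : {set K}) :
  (forall u, u \in N -> L u \subset S) ->
  \sum_(u in N) #|L u| = \sum_(i in S) #|[set u in N | i \in L u]|.
Proof.
move=> LS; under eq_bigr => u uN.
  have -> : #|L u| = \sum_(i in S) (i \in L u : nat).
    rewrite -sum1_card big_mkcond [RHS]big_mkcond /=; apply: eq_bigr => i _.
    by case: ifP => [/(subsetP (LS _ uN)) ->|]; rewrite ?if_same.
over.
rewrite exchange_big /=; apply: eq_bigr => i _.
rewrite -sum1_card big_mkcond [RHS]big_mkcond /=; apply: eq_bigr => u _.
by rewrite inE; case: (u \in N); case: (i \in L u).
Qed.

(* Attaching a new vertex with neighborhood [N] amounts to recoloring [H] so that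
distinct missing colors can be picked at the vertices of [N]. *)
Definition star_colorable (H : rel V) (S : {set K}) (N : {set V}) :=
  exists (c' : V -> V -> K) (d : V -> K),
  [/\ proper_on H c', (forall x y, H x y -> c' x y \in S),
    {in N &, injective d}, (forall u, u \in N -> d u \in S) &
    (forall u y, u \in N -> H u y -> c' u y != d u)].

(* The bound on the sum says that each [L u] has two elements, except that one of
them may have a single one. *)
Definition star_colorable_at (n : nat) :=
  forall (H : rel V) (S : {set K}) (c : V -> V -> K) (N : {set V}) (L : V -> {set K}),
  #|N| = n -> symmetric H -> proper_on H c ->
  (forall x y, H x y -> c x y \in S) ->
  (forall u, u \in N -> L u \subset S) ->
  (forall u y, u \in N -> H u y -> c u y \notin L u) ->
  (forall u, u \in N -> #|L u| <= 2) ->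
  #|N|.*2 <= \sum_(u in N) #|L u| + 1 ->
  #|N| <= #|S| ->
  star_colorable H S N.

(** The color [i] goes to [u]; the class [i] of [H] is set aside during the induction and put back
    afterwards. Dropping [u] and [i] costs the sum at most two, plus one for each other vertex
    offering [i], which the bound allows. *)
Lemma star_sdr_assign (n : nat) (H : rel V) (S : {set K}) (c : V -> V -> K)
    (N : {set V}) (L : V -> {set K}) (u : V) (i : K) :
  star_colorable_at n -> #|N| = n.+1 -> symmetric H -> proper_on H c ->
  (forall x y, H x y -> c x y \in S) ->
  (forall u, u \in N -> L u \subset S) ->
  (forall u y, u \in N -> H u y -> c u y \notin L u) ->
  (forall u, u \in N -> #|L u| <= 2) ->
  u \in N -> i \in L u ->
  #|N|.*2 + #|[set w in N | i \in L w]| <= \sum_(u in N) #|L u| + 2 ->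
  #|N| <= #|S| ->
  star_colorable H S N.
Proof.
move=> IHn Nn Hsym [csym cprop] cS LS Lmiss L2 uN iu Ls NS.
have iS : i \in S := subsetP (LS _ uN) _ iu.
pose H' := [rel x y | H x y && (c x y != i)].
have cH x y : H x y -> ~~ H' x y -> c x y = i.
  by move=> xy; rewrite /= xy negbK => /eqP.
have [|||||||||c' [d [[c's c'p] c'S dI dS dm]]] :=
    IHn H' (S :\ i) c (N :\ u) (fun w => L w :\ i).
- by move: Nn; rewrite (cardsD1 u) uN => -[].
- by move=> x y /=; rewrite Hsym; case yx: (H y x) => //=; rewrite (csym _ _ yx).
- split=> [x y /andP[xy _]|x y z /andP[xy _] /andP[xz _]]; first exact: csym.
  exact: cprop.
- by move=> x y /andP[xy ci]; rewrite !inE ci cS.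
- by move=> w /setD1P[_ wN]; apply: setSD; apply: LS.
- move=> w y /setD1P[_ wN] /andP[wy _]; rewrite inE negb_and.
  by rewrite (Lmiss w y) ?orbT.
- move=> w /setD1P[_ wN]; apply: leq_trans (L2 w wN).
  by apply: subset_leq_card; apply: subD1set.
- have e : \sum_(w in N) #|L w| = #|L u| + (\sum_(w in N :\ u) #|L w :\ i|
      + #|[set w in N | i \in L w]|.-1).
    rewrite (big_setD1 u) //=; congr addn.
    have -> : #|[set w in N | i \in L w]|.-1 = \sum_(w in N :\ u) (i \in L w : nat).
      rewrite (cardsD1 u) inE uN iu /= -sum1_card big_mkcond [RHS]big_mkcond /=.
      by apply: eq_bigr => w _; rewrite !inE; case: (w != u); case: (w \in N); case: (i \in L w).
    by rewrite -big_split /=; apply: eq_bigr => w _; rewrite (cardsD1 i) addnC.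
  have p : 0 < #|[set w in N | i \in L w]|.
    by apply/card_gt0P; exists u; rewrite inE uN.
  have := L2 u uN; move: Ls; rewrite e [in X in X -> _](cardsD1 u) uN.
  move: p; move: #|L u| #|N :\ u| #|[set w in N | _]| (\sum_(_ in _) _).
  by move=> a b [//|x] y _ /=; lia.
- by move: NS; rewrite (cardsD1 u) uN (cardsD1 i) iS.
exists (fun x y => if H' x y then c' x y else i), (fun w => if w == u then i else d w).
have c'i x y : H' x y -> c' x y != i by move=> /c'S /setD1P[].
split.
- have H's x y : H' x y = H' y x.
    by rewrite /= Hsym; case yx: (H y x) => //=; rewrite (csym _ _ yx).
  split=> [x y xy|x y z xy xz]; first by rewrite H's; case: ifP => // /c's.
  case: ifPn => hy; case: ifPn => hz; first exact: c'p.
  + by move/eqP; rewrite (negPf (c'i _ _ hy)).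
  + by move/esym/eqP; rewrite (negPf (c'i _ _ hz)).
  by move=> _; apply: (cprop x); rewrite ?(cH x).
- by move=> x y xy; case: ifP => // /c'S /setD1P[].
- move=> w z wN zN; case: eqP => [->|/eqP wu]; case: eqP => [->|/eqP zu] //.
  + by move/esym/eqP; have /setD1P[/negPf->] : d z \in S :\ i by apply: dS; rewrite !inE zu.
  + by move/eqP; have /setD1P[/negPf->] : d w \in S :\ i by apply: dS; rewrite !inE wu.
  by apply: dI; rewrite !inE ?wu ?zu.
- move=> w wN; case: eqP => // /eqP wu.
  by have /setD1P[] : d w \in S :\ i by apply: dS; rewrite !inE wu.
move=> w y wN wy; case: (w =P u) => [ewu|/eqP wu]; case: ifPn => [h|nh].
- exact: c'i.
- by have := Lmiss _ _ wN wy; rewrite (cH _ _ wy nh) ewu iu.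
- by apply: dm; rewrite // !inE wu.
rewrite eq_sym.
by have /setD1P[] : d w \in S :\ i by apply: dS; rewrite !inE wu.
Qed.

(** Either some color is offered by so few vertices that it can be assigned, or a Kempe swap brings
    an unoffered color into use; the inner induction is on the number of unoffered colors. *)
Lemma star_sdr (n : nat) : star_colorable_at n.
Proof.
elim: n => [|n IHn] H S c N L Nn Hsym cprop cS LS Lmiss L2 Ls NS.
  have d0 u : u \notin N by rewrite (cards0_eq Nn) inE.
  case: (pickP [pred x : K | true]) => [k _|K0]; last first.
    have V0 (x y : V) : false by have := K0 (c x y).
    exists c, (fun x => c x x); split=> // x; by have := V0 x x.
  by exists c, (fun=> k); split=> // u; rewrite (negPf (d0 u)).
pose X l := [set u in N | l \in L u].
have [m] := ubnP #|[set l in S | [forall u in N, l \notin L u]]|.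
elim: m => // m IHm in c L cprop cS LS Lmiss L2 Ls @X *; rewrite ltnS => Xm.
have XE := sum_card_occ LS.
have assign i : 0 < #|X i| -> #|N|.*2 + #|X i| <= \sum_(u in N) #|L u| + 2 ->
    star_colorable H S N.
  case/card_gt0P=> u /setIdP[uN iu] Xs.
  exact: star_sdr_assign IHn Nn Hsym cprop cS LS Lmiss L2 uN iu Xs NS.
have XS i : 0 < #|X i| -> i \in S.
  by case/card_gt0P=> u /setIdP[uN iu]; apply: (subsetP (LS u uN)).
have [/existsP[i /eqP Xi]|no1] := boolP [exists i, #|X i| == 1].
  by apply: (assign i); lia.
have {}no1 i : #|X i| != 1 by move/existsPn: no1; apply.
have [/existsP[j Xj]|no3] := boolP [exists j, 2 < #|X j|]; last first.
  (* Each color is now offered by zero or two vertices, so the sum is even. Parity gains one in the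
     bound, enough to assign a color offered twice. *)
  have {}no3 i : #|X i| <= 2 by move/existsPn: no3 => /(_ i); rewrite -leqNgt.
  have Xev i : ~~ odd #|X i| by move: (no1 i) (no3 i); case: #|X i| => [|[|[]]].
  have Sev : ~~ odd (\sum_(u in N) #|L u|).
    by rewrite XE; elim/big_ind: _ => [//|x y /negPf ox /negPf oy|i _];
      [rewrite oddD ox oy | apply: Xev].
  have [i Xi] : exists i, 0 < #|X i|.
    apply/existsP; apply: contraT => /existsPn h.
    move: Ls; rewrite XE big1 ?Nn // => i _.
    by apply/eqP; have := h i; rewrite -eqn0Ngt.
  by apply: (assign i) => //; move: (no3 i) (no1 i); lia.
have [/existsP[i /andP[iS /eqP Xi]]|no0] := boolP [exists i, (i \in S) && (#|X i| == 0)].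
  have iL u : u \in N -> i \notin L u.
    by move=> uN; move/eqP: Xi; rewrite cards_eq0 => /eqP/setP/(_ u); rewrite !inE uN /= => ->.
  have [c' [L' [c'prop c'S L'S L'm lt]]] :=
    kempe_swap Hsym cprop cS LS Lmiss iS (XS j (ltnW (ltnW Xj))) iL Xj.
  apply: (IHm c' L') => //.
  - by move=> u /L'S[].
  - by move=> u uN; have [_ ->] := L'S u uN; apply: L2.
  - by rewrite (eq_bigr (fun u => #|L u|)) // => u /L'S[].
  by apply: leq_trans Xm; apply: proper_card.
(* Every color of [S] is now offered at least twice and [j] three times, so the sum exceeds
   [#|S|.*2], hence also [#|N|.*2]. *)
exfalso.
have X2 i : i \in S -> 2 <= #|X i|.
  move=> iS; move/existsPn: no0 => /(_ i); rewrite iS /=; have := no1 i; lia.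
have jS : j \in S by apply: XS; lia.
have h1 : \sum_(u in N) #|L u| <= #|N| * 2 by rewrite -sum_nat_const; apply: leq_sum.
have h2 : \sum_(i in S :\ j) #|X i| >= #|S :\ j| * 2.
  by rewrite -sum_nat_const; apply: leq_sum => i /setD1P[_ /X2].
move: h1; rewrite XE (big_setD1 j) //= => h1.
move: h1 h2 NS Xj; rewrite (cardsD1 j S) jS /X.
move: (\sum_(_ in _) _) #|[set u in N | _]| #|S :\ j| #|N| => a b x y; lia.
Qed.

End Star.

(** Vertices are added one at a time. Before [v] is attached, each neighbor of [v] has fewer than
    [n] colored edges and so misses at least two colors, from which [star_sdr] colors the new
    edges. *)
Theorem vizing (V K : finType) (H : rel V) (n : nat) :
  symmetric H -> irreflexive H -> (forall x, #|[set y | H x y]| <= n) ->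
  n < #|K| -> exists c : V -> V -> K, proper_on H c.
Proof.
move=> Hsym Hirr Hdeg nK.
have [k0 _] : exists k : K, k \in K by apply/card_gt0P; apply: leq_ltn_trans nK.
pose on (W : {set V}) := [rel x y | [&& H x y, x \in W & y \in W]].
suff IH (W : {set V}) : exists c : V -> V -> K, proper_on (on W) c.
  have [c [cs cp]] := IH [set: V]; exists c; split=> [x y xy|x y z xy xz].
    by apply: cs; rewrite /= xy !inE.
  by apply: cp; rewrite /= ?xy ?xz !inE.
have [m] := ubnP #|W|; elim: m W => // m IHm W.
have [->|/set0Pn [v vW]] := eqVneq W set0.
  by exists (fun _ _ => k0); split=> [x y|x y z] /and3P[]; rewrite !inE.
rewrite (cardsD1 v) vW add1n !ltnS => /IHm [c cprop].
set W' := W :\ v in cprop.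
pose N := [set w in W' | H v w].
pose M u := [set l | [forall y, on W' u y ==> (c u y != l)]].
have M2 u : u \in N -> 2 <= #|M u|.
  rewrite inE => /andP[uW' vu].
  have h1 : #|~: M u| <= #|[set y | H u y] :\ v|.
    apply: leq_trans (leq_imset_card (c u) _); apply: subset_leq_card.
    apply/subsetP=> l; rewrite !inE => /forallPn[y]; rewrite negb_imply negbK.
    move=> /andP[/and3P[uy _ yW'] /eqP <-]; apply: imset_f; rewrite !inE uy andbT.
    by case/setD1P: yW'.
  have := cardsC (M u); have := Hdeg u; rewrite (cardsD1 v) inE Hsym vu.
  by move: h1 nK; move: #|_ :\ v| => a; lia.
pose L u := [set l in take 2 (enum (M u))].
have LM u : L u \subset M u.
  by apply/subsetP=> l; rewrite inE => /mem_take; rewrite mem_enum.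
have Lc u : u \in N -> #|L u| = 2.
  move=> uN; rewrite cardsE (card_uniqP _) ?take_uniq ?enum_uniq //.
  by rewrite size_takel // -cardE M2.
have [||||||||c' [d [[c's c'p] _ dI _ dm]]] := @star_sdr V K #|N| (on W') setT c N L erefl.
- by move=> x y /=; rewrite Hsym andbCA andbC -andbA andbCA.
- exact: cprop.
- by [].
- by [].
- move=> u y uN uy; apply: contraTN isT => /(subsetP (LM u)).
  by rewrite inE => /forallP/(_ y)/implyP/(_ uy); rewrite eqxx.
- by move=> u /Lc ->.
- by rewrite (eq_bigr (fun=> 2)) => [|u /Lc//]; rewrite sum_nat_const muln2 leq_addr.
- rewrite cardsT; apply: leq_trans (ltnW nK); apply: leq_trans (Hdeg v).
  by apply: subset_leq_card; apply/subsetP=> u; rewrite !inE => /andP[].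
exists (fun x y => if x == v then d y else if y == v then d x else c' x y).
have onN x : on W v x -> x \in N.
  move=> /and3P[vx _ xW]; rewrite !inE vx xW !andbT.
  by apply: contraTneq vx => ->; rewrite Hirr.
have onD x y : on W x y -> x != v -> y != v -> on W' x y.
  by move=> /and3P[xy xW yW] xv yv; rewrite /= xy !inE xv yv xW.
have onS x y : on W x y -> on W y x by case/and3P=> xy xW yW; rewrite /= Hsym xy xW yW.
split=> [x y xy|x y z xy xz].
  case: (eqVneq x v) => [xv|xv]; case: (eqVneq y v) => [yv|yv] //; first by rewrite xv yv.
  by apply: c's; apply: onD.
case: (eqVneq x v) => [xv|xv].
  by apply: dI; apply: onN; rewrite -xv.
case: (eqVneq y v) => [yv|yv]; case: (eqVneq z v) => [zv|zv].
- by rewrite yv zv.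
- move=> /esym/eqP; apply: contraTeq => _; apply: dm; last exact: onD.
  by apply: onN; apply: onS; rewrite -yv.
- move=> /eqP; apply: contraTeq => _; apply: dm; last exact: onD.
  by apply: onN; apply: onS; rewrite -zv.
by apply: c'p; apply: onD.
Qed.

(** * Coloring the ends of paths *)

(** Two matchings form paths and even cycles, hence a bipartite graph. The sides are told apart by
    comparing the orbits, under the composite [P] of both involutions, of a point and of its image
    under [F]. *)
Lemma alternating_coloring (D : finType) (f g : D -> D) :
  involutive f -> involutive g ->
  exists c : D -> bool,
    (forall d, f d != d -> c (f d) = ~~ c d) /\
    (forall d, g d != d -> c (g d) = ~~ c d).
Proof.
move=> fK gK.
(* Passing to two sheets turns [f] and [g] into fixed-point-free involutions. *)
pose lift (h : D -> D) (p : D * bool) :=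
  if h p.1 == p.1 then (p.1, ~~ p.2) else (h p.1, p.2).
have liftK h : involutive h -> involutive (lift h).
  move=> hK [d b]; rewrite /lift /=; case: (eqVneq (h d) d) => [e|ne] /=.
    by rewrite e eqxx negbK.
  by rewrite hK eq_sym (negPf ne).
have liftN h p : lift h p != p.
  case: p => d b; rewrite /lift /=; case: (h d =P d) => [_|/eqP ne]; rewrite xpair_eqE /=.
    by rewrite eqxx; case: b.
  by rewrite (negPf ne).
set F := lift f; set G := lift g.
have FK : involutive F := liftK f fK; have GK : involutive G := liftK g gK.
pose P p := G (F p); have PI : injective P by apply: inj_comp (inv_inj GK) (inv_inj FK).
have Psym : connect_sym (frel P) := fconnect_sym PI.
have rootP p : froot P (P p) = froot P p.
  by apply/esym/(fingraph.rootP Psym)/fconnect1.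
have PFP p : P (F (P p)) = F p by rewrite /P FK GK.
(* [F] conjugates [P] to its inverse. *)
have FP n p : iter n P (F (iter n P p)) = F p.
  by elim: n => // n IHn; rewrite iterSr iterS PFP IHn.
have rootF p : froot P (F p) != froot P p.
  apply/eqP=> /(fingraph.rootP Psym) /iter_findex; set n := findex _ _ _; set q := F p => e.
  have {}e : iter n P q = F q by rewrite FK.
  have iterI m : injective (iter m P) by elim: m => // m IHm x y /PI /IHm.
  (* The midpoint of the walk from [q] to [F q] would yield a fixed point of [G] for odd [n], of [F]
     for even [n]. *)
  have := odd_double_half n; case: (odd n) => /= nE; move: e; rewrite -nE -addnn ?addnA.
    rewrite add1n addSnnS iterD iterS -(FP n./2 q) => /iterI /eqP.
    by rewrite (negPf (liftN g _)).
  rewrite add0n iterD -(FP n./2 q) => /iterI /eqP; rewrite eq_sym.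
  by rewrite (negPf (liftN f _)).
pose r p := enum_rank (froot P p).
have rP p : r (P p) = r p by rewrite /r rootP.
have rF p : (r (F p) < r (F (F p))) = ~~ (r p < r (F p)).
  rewrite FK; case: ltngtP => // e; have := rootF p.
  by rewrite (enum_rank_inj (val_inj e)) eqxx.
exists (fun d => r (d, true) < r (F (d, true))); split=> d nd.
  rewrite -rF; suff -> : F (d, true) = (f d, true) by [].
  by rewrite /F /lift (negPf nd).
have -> : (g d, true) = G (d, true) by rewrite /G /lift (negPf nd).
rewrite -rF -(rP (F (G _))) /P FK GK FK.
by rewrite -{1}(FK (d, true)) -/(P _) rP.
Qed.

(** Greedy matching: two elements of [F] with the same key are paired and removed as long as such a
    pair exists. *)
Lemma pairing (D : finType) (K : eqType) (key : D -> K) (F : {set D}) :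
  exists g : D -> D,
  [/\ involutive g, (forall d, key (g d) = key d), (forall d, d \notin F -> g d = d) &
    {in F &, forall d d', key d = key d' -> g d = d -> g d' = d' -> d = d'}].
Proof.
have [m] := ubnP #|F|; elim: m F => // m IHm F Fm.
have [/existsP[d /existsP[d' /and4P[dF d'F ndd' /eqP kdd']]]|no] :=
  boolP [exists d, exists d', [&& d \in F, d' \in F, d != d' & key d == key d']]; last first.
  exists id; split=> // d d' dF d'F kdd' _ _; apply: contraNeq no => ndd'.
  by apply/existsP; exists d; apply/existsP; exists d'; rewrite dF d'F ndd' kdd' eqxx.
have [|g [gK gkey gF gfix]] := IHm ((F :\ d) :\ d').
  by move: Fm; rewrite (cardsD1 d) dF (cardsD1 d') !inE eq_sym ndd' d'F; lia.
have gd : g d = d by apply: gF; rewrite !inE eqxx andbF.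
have gd' : g d' = d' by apply: gF; rewrite !inE eqxx.
have s12 x : (g x == d) = (x == d) by rewrite -{1}gd (inj_eq (inv_inj gK)).
have s12' x : (g x == d') = (x == d') by rewrite -{1}gd' (inj_eq (inv_inj gK)).
exists (fun x => if x == d then d' else if x == d' then d else g x).
split=> [x|x|x xF|x y xF yF kxy].
- case: (eqVneq x d) => [->|xd]; first by rewrite eq_sym (negPf ndd') eqxx.
  case: (eqVneq x d') => [->|xd']; first by rewrite eqxx.
  by rewrite s12 s12' (negPf xd) (negPf xd') gK.
- case: (eqVneq x d) => [->//|xd].
  by case: (eqVneq x d') => [->//|xd'].
- have [e|_] := eqVneq x d; first by rewrite e dF in xF.
  have [e|_] := eqVneq x d'; first by rewrite e d'F in xF.
  by apply: gF; rewrite !inE (negPf xF) !andbF.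
case: (eqVneq x d) => [->|xd]; first by move/eqP; rewrite eq_sym (negPf ndd').
case: (eqVneq x d') => [->|xd']; first by move/eqP; rewrite (negPf ndd').
case: (eqVneq y d) => [->|yd]; first by move=> _ /eqP; rewrite eq_sym (negPf ndd').
case: (eqVneq y d') => [->|yd']; first by move=> _ /eqP; rewrite (negPf ndd').
by apply: gfix; rewrite // !inE ?xd ?xd' ?yd ?yd'.
Qed.

(** Links under [f] and hard links force equal values, while a soft link needs only one good end.
    The alternating coloring [c] directs every chain and marks exactly one end of each soft link;
    each chain takes the value that is good at the end where its walk stops. *)
Lemma link_assignment (D : finType) (f g : D -> D) (hard : pred D) (x : D -> bool) :
  involutive f -> involutive g -> (forall d, hard (g d) = hard d) ->
  exists t : D -> bool,
  [/\ (forall d, t (f d) = t d), (forall d, hard d -> t (g d) = t d) &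
    (forall d, ~~ hard d -> g d != d -> (t d != x d) || (t (g d) != x (g d)))].
Proof.
move=> fK gK hardg; have [c [cf cg]] := alternating_coloring fK gK.
(* Walks along a chain of hard links; the value of [t] is decided at its end. *)
pose step d := if [&& c d, hard d & g d != d] then f (g d) else d.
(* The default [false] is for walks that run around a closed chain and never stop; there any
   constant would do. *)
pose T d := if [pick z | fconnect step d z && (step z == z)] is Some z then ~~ x z else false.
have Tstep d : T (step d) = T d.
  rewrite /T; congr (if _ is Some z then _ else _); apply: eq_pick => z /=.
  have [zfix|] := eqVneq (step z) z; rewrite ?andbF // !andbT.
  apply/idP/idP=> [|/iter_findex]; first by apply: connect_trans; apply: fconnect1.
  case: (findex _ _ _) => [/= ->|n <-]; first by rewrite zfix connect0.
  by rewrite iterSr fconnect_iter.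
have Tend d : step d = d -> T d = ~~ x d.
  move=> dfix; rewrite /T; case: pickP => [z /andP[/iter_findex <- _]|/(_ d)].
    by rewrite iter_fix.
  by rewrite connect0 dfix eqxx.
pose t d := T (if c d then d else f d).
have tg d : c d -> hard d -> t (g d) = t d.
  move=> cd hd; have [->//|nd] := eqVneq (g d) d.
  by rewrite /t cg // cd /= -[RHS]Tstep /step cd hd nd.
have ts d : c d -> ~~ hard d -> t d != x d.
  move=> cd hd; rewrite /t cd Tend; first by case: (x d).
  by rewrite /step (negPf hd) andbF.
exists t; split=> [d|d hd|d hd nd].
- have [->//|nd] := eqVneq (f d) d.
  by rewrite /t cf // fK; case: (c d).
- have [->//|nd] := eqVneq (g d) d; case cd: (c d); first exact: tg.
  by rewrite -[in RHS](gK d) [RHS]tg // ?hardg // cg ?cd.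
case cd: (c d); first by rewrite ts.
by rewrite [X in _ || X]ts ?orbT ?hardg // cg ?cd.
Qed.

(** Outside the exceptions [X], the map [g] sends [P] injectively into [S :\: P], so only [X] lets
    [P] exceed half of [S]. *)
Lemma card_half_mate (D : finType) (g : D -> D) (S P X : {set D}) :
  injective g -> P \subset S -> (forall d, d \in P -> d \notin X -> g d \in S :\: P) ->
  #|P|.*2 <= #|S| + #|X|.
Proof.
move=> gI PS gP; rewrite -addnn -(cardsID P S) (setIidPr PS) -addnA leq_add2l.
rewrite -(cardsID X P) addnC; apply: leq_add; last by rewrite subset_leq_card ?subsetIr.
rewrite -(card_imset _ gI); apply: subset_leq_card; apply/subsetP=> y /imsetP[d].
by move=> /setDP[dP dX] ->; apply: gP.
Qed.

(** * Distributing the edges among the palettes *)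

Lemma palette_split (V : finType) (G1 G2 : rel V) (k : nat) (par : bool)
    (cA cB : V -> V -> 'I_k.+1 * bool) :
  symmetric G1 -> symmetric G2 -> irreflexive G1 -> irreflexive G2 ->
  (forall v, #|[set w | G1 v w]| <= par + k.*2) ->
  (forall v, #|[set w | G2 v w]| <= par + k.*2) ->
  proper_on G1 cA -> proper_on G2 cB ->
  exists (P2 P3 : rel V) (a : V -> V -> 'I_k.+1),
  [/\ symmetric P2 /\ symmetric P3, subrel P2 G1 /\ subrel P3 G2,
    (forall v, #|[set w | P2 v w]| <= par + k),
    (forall v, #|[set w | P3 v w]| <= k.+1) &
    proper_on [rel x y | [&& G1 x y, ~~ P2 x y & ~~ P3 x y]] a /\
    proper_on [rel x y | [&& G2 x y, ~~ P2 x y & ~~ P3 x y]] a].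
Proof.
move=> sym1 sym2 irr1 irr2 deg1 deg2 [cAs cAp] [cBs cBp].
(* [d = (x, y)] is the end at [x] of the edge [xy], [f d] its other end. *)
pose f (d : V * V) := (d.2, d.1).
have fK : involutive f by case.
pose g1_ (d : V * V) := G1 d.1 d.2; pose g2_ (d : V * V) := G2 d.1 d.2.
pose o d := enum_rank d < enum_rank (f d).
pose col d := if g1_ d then cA d.1 d.2 else cB d.1 d.2.
pose ty d := (g1_ d, g2_ d).
pose isC d := g1_ d && g2_ d.
(* Within A or B at most two ends at a vertex share an index, and [p] links those; common edges are
   linked freely among ends of equal orientation. *)
pose idx d : nat := if isC d then o d : nat else (col d).1.
pose F := [set d | g1_ d || g2_ d].
(* Three rounds of matching: [p] links ends along a path, [q] and [r] match the
remaining ends, first within A, B or C, then across them. *)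
have [p [pK pkey pF pfix]] := pairing (fun d => (d.1, ty d, idx d)) F.
have p1 d : (p d).1 = d.1 by case: (pkey d).
have pty d : ty (p d) = ty d by case: (pkey d) => _ e1 e2 _; rewrite /ty e1 e2.
have pidx d : idx (p d) = idx d by case: (pkey d).
have [c [cf cp]] := alternating_coloring fK pK.
(* Reading [c] at the outgoing end gives both ends of a common edge the same bit. This bit still
   flips across [p], which preserves the orientation. *)
pose h0 d := if isC d then c (if o d then d else f d) else (col d).2.
(* [cls d] tells which palette the matches of [d] protect: [false] for palette 2,
[true] for palette 3. *)
pose cls d := if isC d then par && o d else g2_ d.
have [q [qK qkey qF qfix]] := pairing (fun d => (d.1, ty d, cls d)) [set d in F | p d == d].
have [r [rK rkey rF rfix]] := pairing (fun d => (d.1, cls d)) [set d in F | (p d == d) && (q d == d)].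
pose g d := if p d != d then p d else if q d != d then q d else r d.
have inv_move (s : V * V -> V * V) (W : {set V * V}) d : involutive s ->
    (forall d, d \notin W -> s d = d) -> s d != d -> s d \in W.
  by move=> sK sW; apply: contraNT => /sW; rewrite sK => e; rewrite -e.
have pq d : q d != d -> p (q d) = q d.
  by move/(inv_move q _ d qK qF); rewrite !inE => /andP[_ /eqP].
have pr d : r d != d -> p (r d) = r d /\ q (r d) = r d.
  by move/(inv_move r _ d rK rF); rewrite !inE => /and3P[_ /eqP-> /eqP->].
have gK : involutive g.
  move=> d; rewrite /g; have [pd|npd] := eqVneq (p d) d; last by rewrite pK eq_sym npd.
  have [qd|nqd] := eqVneq (q d) d; last by rewrite pq // eqxx qK eq_sym nqd.
  have [rd|nrd] := eqVneq (r d) d; first by rewrite rd pd qd !eqxx rd.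
  by have [-> ->] := pr d nrd; rewrite !eqxx rK.
have hardg d : (p (g d) != g d) = (p d != d).
  rewrite /g; have [pd|npd] := eqVneq (p d) d; last by rewrite pK eq_sym npd.
  have [qd|nqd] := eqVneq (q d) d; last by rewrite pq // eqxx.
  have [rd|nrd] := eqVneq (r d) d; first by rewrite rd pd eqxx.
  by have [-> _] := pr d nrd; rewrite eqxx.
(* This is the value of [h d] that puts [d] into the palette [cls d]; it is false only for common
   edges and palette 3. *)
pose bad d := ~~ (cls d && g1_ d).
have [t [tf th ts]] := @link_assignment _ f g (fun d => p d != d) (fun d => h0 d (+) bad d) fK gK hardg.
(* An end of A or B is in palette 1 unless [h d]; an end of C is in palette 2 if
[h d], in palette 3 otherwise. *)
pose h d := h0 d (+) t d.
have g1f d : g1_ (f d) = g1_ d by apply: sym1.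
have g2f d : g2_ (f d) = g2_ d by apply: sym2.
have isCf d : isC (f d) = isC d by rewrite /isC g1f g2f.
have fN d : d \in F -> f d != d.
  case: d => x y; rewrite inE /g1_ /g2_ /f xpair_eqE /=; case: eqP => // -> .
  by rewrite irr1 irr2.
have of_ d : d \in F -> o (f d) = ~~ o d.
  move=> dF; rewrite /o fK; case: ltngtP => // e; have := fN d dF.
  by rewrite (enum_rank_inj (val_inj e)) eqxx.
have colf d : d \in F -> col (f d) = col d.
  rewrite inE /col g1f; case: ifPn => [d1 _|_ /= d2]; first by rewrite [LHS]cAs // sym1.
  by rewrite [LHS]cBs // sym2.
have isCF d : isC d -> d \in F by rewrite inE => /andP[->].
have h0f d : d \in F -> h0 (f d) = h0 d.
  move=> dF; rewrite /h0 isCf; case: ifP => _; last by rewrite colf.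
  by rewrite of_ // fK; case: (o d).
have hf d : d \in F -> h (f d) = h d by move=> dF; rewrite /h h0f // tf.
have FE d : (p d \in F) = (d \in F).
  by rewrite !inE; case: (pty d) => -> ->.
have isCp d : isC (p d) = isC d by rewrite /isC; case: (pty d) => -> ->.
have op d : isC d -> o (p d) = o d.
  by move=> Cd; have := pidx d; rewrite /idx isCp Cd; case: (o d); case: (o _).
have colI d d' : d \in F -> d.1 = d'.1 -> ty d = ty d' -> col d = col d' -> d = d'.
  case: d d' => [x y] [x' z] + /= <- {x'} [e1 e2]; rewrite inE /col -e1 /=.
  case: ifPn => [xy _ e|xy /= xy2 e]; congr pair.
    by apply: cAp e => //; rewrite -/(g1_ (x, z)) -e1.
  by apply: cBp e => //; rewrite -/(g2_ (x, z)) -e2.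
have colp d : d \in F -> ~~ isC d -> p d != d ->
    (col (p d)).1 = (col d).1 /\ (col (p d)).2 = ~~ (col d).2.
  move=> dF Cd npd; have := pidx d; rewrite /idx isCp (negPf Cd) => /val_inj e1.
  split=> //; case: (eqVneq (col (p d)).2 (col d).2) => [e2|]; last first.
    by case: (col d).2; case: (_.2).
  case/eqP: npd; apply: colI; rewrite ?FE // ?p1 // ?pty //.
  by rewrite [LHS]surjective_pairing [RHS]surjective_pairing e1 e2.
have h0p d : d \in F -> p d != d -> h0 (p d) = ~~ h0 d.
  move=> dF npd; rewrite /h0 isCp; case: ifPn => Cd; last by case: (colp d dF Cd npd).
  rewrite op //; case: ifP => od; first exact: cp.
  rewrite cf ?fN ?FE // cp // cf ?fN //.
have hp d : d \in F -> p d != d -> h (p d) = ~~ h d.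
  move=> dF npd; rewrite /h h0p // addNb; congr (~~ (_ (+) _)).
  by have := th d npd; rewrite /g npd.
pose inpal j d := if j then g2_ d && (h d != g1_ d) else g1_ d && h d.
have gfst d : (g d).1 = d.1.
  rewrite /g; case: ifP => // _; case: ifP => _; first by case: (qkey d).
  by case: (rkey d).
have gcls d : p d = d -> cls (g d) = cls d.
  move=> pd; rewrite /g pd eqxx /=; case: ifP => _; first by case: (qkey d).
  by case: (rkey d).
have gdeg (j : bool) d : cls d = j -> d \in F -> if j then g2_ d else g1_ d.
  by rewrite /cls /isC inE => <-; case: (g1_ d); case: (g2_ d) => //=; case: ifP.
have gF d : d \in F -> g d \in F.
  rewrite /g; have [pd dF|_] := eqVneq (p d) d; last by rewrite FE.
  have [qd|nqd] := eqVneq (q d) d; last first.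
    by move/(inv_move q _ d qK qF): nqd; rewrite inE => /andP[].
  have [->//|nrd] := eqVneq (r d) d.
  by move/(inv_move r _ d rK rF): nrd; rewrite inE => /andP[].
pose star j v := [set d : V * V | (d.1 == v) && (if j then g2_ d else g1_ d)].
have starF j v d : d \in star j v -> d \in F.
  by rewrite !inE => /andP[_]; case: j => ->; rewrite ?orbT.
have gfix d : g d = d -> [/\ p d = d, q d = d & r d = d].
  rewrite /g; have [pd|npd] := eqVneq (p d) d; last by move/eqP; rewrite (negPf npd).
  by have [qd|nqd] := eqVneq (q d) d; last by move/eqP; rewrite (negPf nqd).
have otherC (j : bool) d : (if j then g2_ d else g1_ d) -> cls d != j -> isC d.
  by rewrite /cls /isC; case: j; case: (g1_ d); case: (g2_ d).
have palbad (j : bool) d : cls d = j -> inpal j d -> t d = h0 d (+) bad d.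
  rewrite /inpal /bad /h => ->; case: j => /= /andP[_].
    by case: (h0 d); case: (t d); case: (g1_ d).
  by case: (h0 d); case: (t d).
have balance j v : #|[set d in star j v | inpal j d]|.*2 <=
    #|star j v| + (1 + (par + (~~ par && j).*2)).
  (* [X1] holds the end of class [j] that may stay unmatched; [X2] holds the common ends protecting
     the other palette, at most one per orientation. If [par] holds, the two orientations protect
     different palettes; otherwise both protect palette 2, and only palette 3 suffers these two
     exceptions. *)
  pose X1 := [set d in star j v | (g d == d) && (cls d == j)].
  pose X2 := [set d in star j v | (p d == d) && (cls d != j)].
  have X1c : #|X1| <= 1.
    apply/card_le1_eqP => d d' /setIdP[dS /andP[/eqP gd /eqP cd]].
    move=> /setIdP[d'S /andP[/eqP gd' /eqP cd']].
    have [pd qd rd] := gfix d gd; have [pd' qd' rd'] := gfix d' gd'.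
    have dW : d \in [set d in F | (p d == d) && (q d == d)].
      by apply/setIdP; split; [exact: starF dS | rewrite pd qd !eqxx].
    have d'W : d' \in [set d in F | (p d == d) && (q d == d)].
      by apply/setIdP; split; [exact: starF d'S | rewrite pd' qd' !eqxx].
    apply: (rfix d' d d'W dW) => //; rewrite cd cd'.
    by move: dS d'S; rewrite !inE => /andP[/eqP-> _] /andP[/eqP-> _].
  have X2C d : d \in X2 -> isC d.
    case/setIdP=> dS /andP[_]; apply: otherC.
    by move: dS; rewrite inE => /andP[].
  have X2c : #|X2| <= par + (~~ par && j).*2.
    rewrite -(card_in_imset (f := o) (D := mem X2)); last first.
      move=> d d' dX d'X odd'; have Cd := X2C _ dX; have Cd' := X2C _ d'X.
      move: dX d'X; rewrite !inE => /andP[/andP[/eqP dv _] /andP[/eqP pd _]].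
      move=> /andP[/andP[/eqP dv' _] /andP[/eqP pd' _]].
      apply: pfix; rewrite ?isCF // dv dv' /idx Cd Cd' odd' /ty.
      by case/andP: Cd => -> ->; case/andP: Cd' => -> ->.
    have oX b : b \in o @: X2 -> (par && b) != j.
      case/imsetP=> d dX ->; have := dX; rewrite inE => /and3P[_ _].
      by rewrite /cls X2C.
    have [om|om] := boolP par.
      apply: (@leq_trans #|[set ~~ j]|); last by rewrite cards1.
      apply: subset_leq_card; apply/subsetP=> b /oX.
      by rewrite om inE; case: b; case: (j).
    have [jt|jf] := boolP j; first by apply: leq_trans (max_card _) _; rewrite card_bool.
    rewrite leqn0 cards_eq0 -subset0; apply/subsetP=> b /oX.
    by rewrite (negPf om) (negPf jf).
  apply: leq_trans (card_half_mate (g := g) (S := star j v) (X := X1 :|: X2) _ _ _) _.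
  - exact: inv_inj.
  - by apply/subsetP=> d /setIdP[].
  - move=> d /setIdP[dS dp]; rewrite !in_setU negb_or => /andP[dX1 dX2].
    have dF := starF _ _ _ dS; move: (dS); rewrite inE => /andP[/eqP dv dj].
    have [pd|npd] := eqVneq (p d) d; last first.
      have -> : g d = p d by rewrite /g npd.
      case: (pty d) => e1 e2; rewrite !inE p1 dv eqxx e1 e2 dj andbT /=.
      move: dp; rewrite /inpal hp // e1 e2 (fun_if negb).
      by case: (j); case: (h d); case: (g1_ d); case: (g2_ d).
    have cd : cls d = j by apply/eqP; move: dX2; rewrite inE dS pd eqxx negbK.
    have ngd : g d != d by move: dX1; rewrite inE dS cd eqxx andbT.
    have cgd : cls (g d) = j by rewrite gcls.
    rewrite !inE gfst dv eqxx (gdeg j) ?gF // !andbT /=.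
    have := ts d; rewrite pd eqxx => /(_ isT ngd); apply: contraTN => gp.
    by rewrite (palbad j) // (palbad j (g d)) // !eqxx.
  by rewrite leq_add2l; apply: leq_trans (leq_card_setU _ _) _; apply: leq_add.
have card_star (Q : pred (V * V)) v : #|[set w | Q (v, w)]| = #|[set d | (d.1 == v) && Q d]|.
  rewrite -(card_imset _ (f := pair v)); last by move=> x y [].
  apply: eq_card => -[x y]; rewrite !inE /=; apply/imsetP/andP => [[w]|[/eqP-> Qy]].
    by rewrite inE => Qw [-> ->].
  by exists y; rewrite ?inE.
have palE j v : #|[set w | inpal j (v, w)]| = #|[set d in star j v | inpal j d]|.
  rewrite card_star; apply: eq_card => d; rewrite !inE -andbA; congr (_ && _).
  by rewrite /inpal; case: (j); [case: (g2_ d) | case: (g1_ d)].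
have inpalF j d : inpal j d -> d \in F.
  by rewrite inE /inpal; case: j => /andP[->]; rewrite ?orbT.
have inpalf j d : d \in F -> inpal j (f d) = inpal j d.
  by move=> dF; rewrite /inpal g1f g2f hf.
have pal_sym j : symmetric (fun x y => inpal j (x, y)).
  move=> x y; apply/idP/idP => xy; first by rewrite -[(y, x)]/(f (x, y)) inpalf ?(inpalF _ _ xy).
  by rewrite -[(x, y)]/(f (y, x)) inpalf ?(inpalF _ _ xy).
exists (fun x y => inpal false (x, y)), (fun x y => inpal true (x, y)), (fun x y => (col (x, y)).1).
have starE1 v : #|star false v| <= par + k.*2.
  by apply: leq_trans (deg1 v); rewrite (card_star g1_).
have starE2 v : #|star true v| <= par + k.*2.
  by apply: leq_trans (deg2 v); rewrite (card_star g2_).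
split.
- by [].
- by split=> x y /andP[].
(* Halving rounds down: [k.*2 + 1] gives [k] for palette 2 without [par], and [k.*2 + 3] gives
   [k.+1] in all other cases. *)
- move=> v; rewrite palE; move: (balance false v) (starE1 v); case: (par); lia.
- move=> v; rewrite palE; move: (balance true v) (starE2 v); case: (par); lia.
(* Two edges of A, or two of B, with the same index at a vertex are equal or linked by [p]; in the
   latter case [h] differs, so one of them has left palette 1. *)
have colE d d' : d \in F -> d.1 = d'.1 -> ty d = ty d' -> ~~ isC d ->
    ~~ h d -> ~~ h d' -> (col d).1 = (col d').1 -> p d != d -> d = d'.
  move=> dF d1 dty nC hd hd' e1 npd; have [c1 c2] := colp d dF nC npd.
  case: (eqVneq (col d).2 (col d').2) => e2.
    by apply: colI => //; rewrite [LHS]surjective_pairing [RHS]surjective_pairing e1 e2.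
  case/negP: hd'; suff <- : p d = d' by rewrite hp.
  apply: colI; rewrite ?FE ?p1 ?pty //.
  rewrite [LHS]surjective_pairing [RHS]surjective_pairing c1 c2 e1; congr pair.
  by move: e2; case: (col d).2; case: (col d').2.
have idx_proper d d' : d \in F -> d.1 = d'.1 -> ty d = ty d' -> ~~ isC d ->
    ~~ h d -> ~~ h d' -> (col d).1 = (col d').1 -> d = d'.
  move=> dF d1 dty nC hd hd' e1; have [pd|/colE] := eqVneq (p d) d; last exact.
  have [e e'] : g1_ d = g1_ d' /\ g2_ d = g2_ d' by case: dty.
  have d'F : d' \in F by move: dF; rewrite !inE e e'.
  have nC' : ~~ isC d' by rewrite /isC -e -e'.
  have [pd'|/colE H] := eqVneq (p d') d'; last by apply/esym/H.
  by apply: pfix; rewrite // /idx (negPf nC) (negPf nC') d1 dty e1.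
have colS x y : (x, y) \in F -> (col (x, y)).1 = (col (y, x)).1.
  by move=> xyF; rewrite -[(y, x)]/(f (x, y)) colf.
have unused x y : (x, y) \in F -> ~~ inpal false (x, y) -> ~~ inpal true (x, y) ->
    ~~ isC (x, y) /\ ~~ h (x, y).
  rewrite inE /inpal /isC; case: (g1_ (x, y)); case: (g2_ (x, y)) => //= _;
  by case: (h (x, y)).
split; split=> [x y /andP[xy _]|x y z /and3P[xy xy2 xy3] /and3P[xz xz2 xz3] e].
- by apply: colS; rewrite inE /g1_ xy.
- have xyF : (x, y) \in F by rewrite inE /g1_ xy.
  have xzF : (x, z) \in F by rewrite inE /g1_ xz.
  have [nC hy] := unused x y xyF xy2 xy3; have [nC' hz] := unused x z xzF xz2 xz3.
  suff [] : (x, y) = (x, z) by [].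
  apply: idx_proper => //; move: nC nC'; rewrite /ty /isC /g1_ /g2_ /= xy xz /=.
  by case: (G2 x y); case: (G2 x z).
- by apply: colS; rewrite inE /g2_ xy orbT.
have xyF : (x, y) \in F by rewrite inE /g2_ xy orbT.
have xzF : (x, z) \in F by rewrite inE /g2_ xz orbT.
have [nC hy] := unused x y xyF xy2 xy3; have [nC' hz] := unused x z xzF xz2 xz3.
suff [] : (x, y) = (x, z) by [].
apply: idx_proper => //; move: nC nC'; rewrite /ty /isC /g1_ /g2_ /= xy xz /=.
by case: (G1 x y); case: (G1 x z).
Qed.

(** * Assembling the three palettes *)

Lemma simultaneous_proper_on (V : finType) (G1 G2 : rel V) (D : nat) :
  symmetric G1 -> symmetric G2 -> irreflexive G1 -> irreflexive G2 ->
  (forall v, #|[set w | G1 v w]| <= D) -> (forall v, #|[set w | G2 v w]| <= D) ->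
  exists c : V -> V -> 'I_((3 * D) %/ 2 + 4), proper_on G1 c /\ proper_on G2 c.
Proof.
move=> sym1 sym2 irr1 irr2; rewrite -{1 2}(odd_double_half D) => deg1 deg2.
set k := D./2 in deg1 deg2.
have cardA : odd D + k.*2 < #|{: 'I_k.+1 * bool}|.
  by rewrite card_prod card_ord card_bool; case: (odd D); lia.
have [cA cAp] := vizing sym1 irr1 deg1 cardA.
have [cB cBp] := vizing sym2 irr2 deg2 cardA.
have [P2 [P3 [a [[s2 s3] [sub2 sub3] d2 d3 [[as1 ap1] [as2 ap2]]]]]] :=
  palette_split sym1 sym2 irr1 irr2 deg1 deg2 cAp cBp.
have irr2' : irreflexive P2 by move=> x; apply/negP=> /sub2; rewrite irr1.
have irr3' : irreflexive P3 by move=> x; apply/negP=> /sub3; rewrite irr2.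
have [c2 [c2s c2p]] := @vizing _ 'I_(odd D + k).+1 _ _ s2 irr2' d2 (ltac:(by rewrite card_ord)).
have [c3 [c3s c3p]] := @vizing _ 'I_k.+2 _ _ s3 irr3' d3 (ltac:(by rewrite card_ord)).
pose K : finType := ('I_k.+1 + 'I_(odd D + k).+1 + 'I_k.+2)%type.
(* The palettes have [k + 1], [odd D + k + 1] and [k + 2] colors, in total [3 * k + odd D + 4],
   which is exactly the bound. *)
have KN : #|K| <= (3 * D) %/ 2 + 4.
  rewrite !card_sum !card_ord -[in X in _ <= X](odd_double_half D) -/k.
  by case: (odd D); lia.
pose c x y : K := if P2 x y then inl (inr (c2 x y)) else
  if P3 x y then inr (c3 x y) else inl (inl (a x y)).
have wI : injective (fun z : K => widen_ord KN (enum_rank z)).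
  by move=> z t /(congr1 val) /= /val_inj /enum_rank_inj.
exists (fun x y => widen_ord KN (enum_rank (c x y))).
have cs (H : rel V) : (forall x y, [&& H x y, ~~ P2 x y & ~~ P3 x y] -> a x y = a y x) ->
    forall x y, H x y -> c x y = c y x.
  move=> ha x y xy; rewrite /c (s2 y x) (s3 y x).
  case: ifPn => [/c2s->//|n2]; case: ifPn => [/c3s->//|n3].
  by rewrite ha // xy n2.
have cp (H : rel V) : (forall x y z, [&& H x y, ~~ P2 x y & ~~ P3 x y] ->
      [&& H x z, ~~ P2 x z & ~~ P3 x z] -> a x y = a x z -> y = z) ->
    forall x y z, H x y -> H x z -> c x y = c x z -> y = z.
  move=> ha x y z xy xz; rewrite /c.
  case: ifPn => hy2; [|case: ifPn => hy3]; (case: ifPn => hz2; [|case: ifPn => hz3]) => // -[].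
  - exact: c2p.
  - exact: c3p.
  by apply: ha; rewrite ?xy ?xz ?hy2 ?hy3 ?hz2 ?hz3.
split; split=> [x y xy|x y z xy xz /wI].
- by rewrite (cs G1).
- exact: (cp G1).
- by rewrite (cs G2).
exact: (cp G2).
Qed.

(** * From colorings of ordered pairs to colorings of edges *)

Section EdgeColoring.
Variable V : finType.

Lemma edge_endpoint (G : sgraph V) (e : edge G) (v : V) :
  v \in val e -> exists2 w, G v w & val e = [set v; w].
Proof.
case: e => e /=; rewrite inE => /existsP[x /existsP[y /andP[xy /eqP->]]].
rewrite !inE => /orP[]/eqP->; first by exists y.
by exists x; rewrite 1?setUC // adj_sym.
Qed.

Lemma set2_inj (v w x y : V) :
  [set v; w] = [set x; y] -> (x, y) = (v, w) \/ (x, y) = (w, v).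
Proof.
move=> e.
have : v \in [set x; y] by rewrite -e !inE eqxx.
have : w \in [set x; y] by rewrite -e !inE eqxx orbT.
have : x \in [set v; w] by rewrite e !inE eqxx.
have : y \in [set v; w] by rewrite e !inE eqxx orbT.
rewrite !inE => /orP[]/eqP-> /orP[]/eqP->; rewrite ?orbb; try by [left | right].
  by move=> /eqP-> _; left.
by move=> _ /eqP->; left.
Qed.

Lemma simul_colorable_of_proper_on (G1 G2 : sgraph V) (n : nat) (c : V -> V -> 'I_n) :
  0 < n -> proper_on G1 c -> proper_on G2 c -> simul_colorable [tuple G1; G2] n.
Proof.
move=> n0 c1 c2; pose Gs := [tuple G1; G2].
(* An edge is colored through whichever ordering of its ends [pick] returns; symmetry of [c] on each
   graph makes the choice immaterial. *)
pose C (e : {set V}) := if [pick p : V * V | e == [set p.1; p.2]] is Some p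
  then c p.1 p.2 else Ordinal n0.
have CE (G : sgraph V) v w : proper_on G c -> G v w -> C [set v; w] = c v w.
  move=> [cs _] vw; rewrite /C; case: pickP => [[x y] /= /eqP|/(_ (v, w))]; last by rewrite eqxx.
  by case/set2_inj=> -[-> ->] //; rewrite -cs.
have cP i : proper_on (tnth Gs i) c.
  by case: i => -[|[|//]] ? /=; rewrite (tnth_nth G1).
apply/existsP; exists [ffun e : edge (union_graph Gs) => C (val e)].
apply/forallP=> i; apply/forallP=> e; apply/forallP=> f; rewrite !ffunE /=.
apply/implyP=> /andP[nef /pred0Pn[v /andP[/= ve vf]]].
have [w vw Ee] := edge_endpoint ve; have [z vz Ef] := edge_endpoint vf.
rewrite Ee Ef (CE _ _ _ (cP i) vw) (CE _ _ _ (cP i) vz).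
apply: contraNneq nef => /(proj2 (cP i) v w z vw vz) wz.
by apply/eqP/val_inj; rewrite Ee Ef wz.
Qed.

Lemma simul_colorable2 (G1 G2 : sgraph V) (D : nat) :
  max_degree G1 <= D -> max_degree G2 <= D ->
  simul_colorable [tuple G1; G2] ((3 * D) %/ 2 + 4).
Proof.
have deg (G : sgraph V) : max_degree G <= D -> forall v, #|[set w | G v w]| <= D.
  by move=> GD v; apply: leq_trans GD; apply: (leq_bigmax v).
move=> /deg deg1 /deg deg2.
have [c [c1 c2]] := simultaneous_proper_on (@adj_sym _ G1) (@adj_sym _ G2)
  (@adj_irr _ G1) (@adj_irr _ G2) deg1 deg2.
by apply: simul_colorable_of_proper_on c1 c2; rewrite addn4.
Qed.

End EdgeColoring.

(** * Existence of the maximum and the floor bound *)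

Lemma attained_index2_le (D j : nat) : attained_index 2 D j -> j <= (3 * D) %/ 2 + 4.
Proof.
case=> V [Gs [degs <-]]; rewrite /simul_chromatic_index; case: ex_minnP => m _; apply.
have -> : Gs = [tuple tnth Gs ord0; tnth Gs (lift ord0 ord0)].
  by apply: eq_from_tnth => -[[|[|//]] hi]; rewrite [RHS](tnth_nth (tnth Gs ord0)) /=;
    congr tnth; apply: val_inj.
exact: simul_colorable2.
Qed.

(** Being attained quantifies over all finite graphs, so excluded middle decides each candidate as
    the bound descends. *)
Lemma bounded_nat_max (P : nat -> Prop) (n : nat) :
  (exists k, P k) -> (forall k, P k -> k <= n) ->
  exists k, P k /\ forall j, P j -> j <= k.
Proof.
move=> exP; elim: n => [|n IHn] Pn.
  by case: exP => k Pk; exists k; split=> // j /Pn; rewrite leqn0 => /eqP->.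
have [Pn1|nPn1] := classic (P n.+1); first by exists n.+1.
apply: IHn => k Pk; have := Pn k Pk; rewrite leq_eqVlt => /orP[/eqP kn|//].
by rewrite kn in Pk.
Qed.

Lemma attained_index_ex (l D : nat) : exists k, attained_index l D k.
Proof.
pose G0 := @SGraph void (fun _ _ => false) (fun _ _ => erefl) (fun _ => erefl).
exists (simul_chromatic_index [tuple of nseq l G0]), void, [tuple of nseq l G0].
by split=> // i; rewrite /max_degree big1 // => -[].
Qed.

Import Order.TTheory GRing.Theory Num.Theory.
Local Open Scope ring_scope.

Lemma color_bound_floor (D : nat) :
  ((3 * D) %/ 2 + 4)%:Z <= Num.floor (3 / 2 * D%:R + 4 : rat).
Proof.
rewrite floor_ge_int -[_%:~R]/(((3 * D) %/ 2 + 4)%N%:R) natrD lerD2r.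
rewrite mulrAC ler_pdivlMr // -!natrM ler_nat.
by rewrite leq_divM.
Qed.

Theorem theorem3 (D : nat) (hD : (0 < D)%N) :
  (exists k : nat, is_max_simul_index 2 D k /\
     k%:Z <= Num.floor (3 / 2 * D%:R + 4 : rat)) /\
  (forall (V : finType) (G1 G2 : sgraph V),
     (max_degree G1 <= D)%N -> (max_degree G2 <= D)%N ->
     exists k : nat, k%:Z <= Num.floor (3 / 2 * D%:R + 4 : rat) /\
       simul_colorable [tuple G1; G2] k).
Proof.
split=> [|V G1 G2 G1D G2D]; last first.
  exists ((3 * D) %/ 2 + 4)%N; split; first exact: color_bound_floor.
  exact: simul_colorable2.
have [k kmax] := bounded_nat_max (attained_index_ex 2 D) (@attained_index2_le D).
exists k; split=> //; apply: le_trans (color_bound_floor D).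
by rewrite lez_nat; apply: attained_index2_le (proj1 kmax).
Qed.
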